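(* (a) If $G_1$ and $G_2$ are $L$-cospectral regular graphs, and $H$ is an arbitrary graph, then $G_1\dot{\vee} H$ and $G_2\dot{\vee} H$ are $L$-cospectral. (b) If $G$ is a regular graph, and $H_1$ and $H_2$ are $L$-cospectral graphs, then $G\dot{\vee} H_1$ and $G\dot{\vee} H_2$ are $L$-cospectral. (c) If $G_1$ and $G_2$ are $L$-cospectral regular graphs, and $H_1$ and $H_2$ are $L$-cospectral graphs, then $G_1\dot{\vee} H_1$ and $G_2\dot{\vee} H_2$ are $L$-cospectral.
   Context: All graphs are finite, simple and undirected, with at least one vertex. $L(G)=D(G)-A(G)$ is the Laplacian matrix of $G$ ($D(G)$ the diagonal degree matrix, $A(G)$ the adjacency matrix); two graphs are $L$-cospectral if their Laplacian matrices have the same spectrum (eigenvalues counted with multiplicity). The subdivision graph $\mathcal{S}(G)$ is obtained from $G$ by inserting a new vertex into every edge of $G$. For vertex-disjoint graphs $G,H$, the subdivision-vertex join $G\dot{\vee}H$ is the graph obtained from $\mathcal{S}(G)$ and $H$ by joining every vertex of $V(G)$ (the original vertices) with every vertex of $V(H)$. *)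

(* Defs.v *)
From mathcomp Require Import all_boot all_order all_algebra all_field.

Set Implicit Arguments.
Unset Strict Implicit.
Unset Printing Implicit Defensive.

Import GRing.Theory.
Local Open Scope ring_scope.

Record graph := Graph {
  vertex :> finType;
  adj : rel vertex;
  adj_sym : symmetric adj;
  adj_irr : irreflexive adj;
  vertex_gt0 : (0 < #|vertex|)%N
}.

Definition degree (G : graph) (v : G) : nat := #|[set w : G | adj v w]|.

Definition regular (G : graph) : Prop := exists r, forall v : G, degree v = r.

(* The vertices are numbered by enum_val; another numbering would conjugate
   these matrices by a permutation matrix.  The entries are taken in algC so
   that all the eigenvalues of these integer matrices are available. *)
Definition adjacency_mx (G : graph) : 'M[algC]_#|G| :=
  \matrix_(i, j) (adj (enum_val i) (enum_val j))%:R.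

Definition degree_mx (G : graph) : 'M[algC]_#|G| :=
  diag_mx (\row_i (degree (enum_val i))%:R).

Definition laplacian (G : graph) : 'M[algC]_#|G| :=
  degree_mx G - adjacency_mx G.

(* The roots of the characteristic polynomial, each listed as many times as
   its multiplicity; the order of the list is irrelevant. *)
Definition spectrum (n : nat) (A : 'M[algC]_n) : seq algC :=
  sval (closed_field_poly_normal (char_poly A)).

Lemma char_poly_spectrum n (A : 'M[algC]_n) :
  char_poly A = \prod_(z <- spectrum A) ('X - z%:P).
Proof.
rewrite /spectrum; case: closed_field_poly_normal => s /= {1}->.
by rewrite (monicP (char_poly_monic A)) scale1r.
Qed.

Lemma mem_spectrum n (A : 'M[algC]_n) a : (a \in spectrum A) = eigenvalue A a.
Proof. by rewrite eigenvalue_root_char char_poly_spectrum root_prod_XsubC. Qed.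

Definition L_cospectral (G1 G2 : graph) : Prop :=
  perm_eq (spectrum (laplacian G1)) (spectrum (laplacian G2)).

Definition edge_set (G : graph) : {set {set G}} :=
  [set [set p.1; p.2] | p : G * G & adj p.1 p.2].

Definition edge (G : graph) : finType := {e : {set G} | e \in edge_set G}.

(* inl v is an original vertex, inr e the vertex inserted into the edge e. *)
Definition subdivision_adj (G : graph) (x y : G + edge G) : bool :=
  match x, y with
  | inl v, inr e | inr e, inl v => v \in val e
  | _, _ => false
  end.

Lemma subdivision_adj_sym (G : graph) : symmetric (@subdivision_adj G).
Proof. by case=> [v|e] [w|f]. Qed.

Lemma subdivision_adj_irr (G : graph) : irreflexive (@subdivision_adj G).
Proof. by case. Qed.

Lemma subdivision_gt0 (G : graph) : (0 < #|{: G + edge G}|)%N.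
Proof. by rewrite card_sum addn_gt0 vertex_gt0. Qed.

Definition subdivision (G : graph) : graph :=
  Graph (@subdivision_adj_sym G) (@subdivision_adj_irr G) (subdivision_gt0 G).

Definition is_original (G : graph) (x : subdivision G) : bool :=
  if x is inl _ then true else false.

Definition svjoin_adj (G H : graph) (x y : subdivision G + H) : bool :=
  match x, y with
  | inl s, inl t => adj s t
  | inr w, inr z => adj w z
  | inl s, inr _ | inr _, inl s => is_original s
  end.

Lemma svjoin_adj_sym (G H : graph) : symmetric (@svjoin_adj G H).
Proof. by case=> [s|w] [t|z] //; apply: adj_sym. Qed.

Lemma svjoin_adj_irr (G H : graph) : irreflexive (@svjoin_adj G H).
Proof. by case=> [s|w]; apply: adj_irr. Qed.

Lemma svjoin_gt0 (G H : graph) : (0 < #|{: subdivision G + H}|)%N.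
Proof. by rewrite card_sum addn_gt0 vertex_gt0. Qed.

(* The subdivision-vertex join of G and H. *)
Definition svjoin (G H : graph) : graph :=
  Graph (@svjoin_adj_sym G H) (@svjoin_adj_irr G H) (svjoin_gt0 G H).

(* Main.v *)
(* Two monic polynomials agree once their values agree off a finite set, so we
   compare det(a I - L) for generic a.  Write n = |V(G)|, m = |E(G)|,
   h = |V(H)|, let G be r-regular and B its incidence matrix.  Eliminating the
   subdividing vertices leaves on V(G) the Schur complement
     S = (a - r - h) I - B B^T / (a - 2) = (p I + L(G)) / (a - 2),
   with p = (a - 2) (a - r - h) - 2 r, because B B^T = 2 r I - L(G).  As L(G)
   kills the all-ones vector, the rows of S sum to s = p / (a - 2), and
   eliminating V(G) turns T = (a - n) I - L(H) into T - (n / s) J, which is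
   T (I - (n / (s (a - n))) J).  The product of determinants obtained depends
   only on n, m, r, h and the two Laplacian characteristic polynomials, and
   n, m, r can be read off that of G (its degree and the trace n r = 2 m). *)
Require Import Defs.
From mathcomp Require Import all_boot all_order all_algebra all_field.
From mathcomp Require Import perm ring.

Set Implicit Arguments.
Unset Strict Implicit.
Unset Printing Implicit Defensive.

Import GRing.Theory Num.Theory.
Local Open Scope ring_scope.

(** * Generic agreement of polynomials, and determinants of block matrices *)

(** If [p - q] were nonzero, so would be [w * (p - q)], which then has a non-root, an algebraically
    closed field being infinite. *)
Lemma poly_eq_off_roots (F : closedFieldType) (w p q : {poly F}) :
  w != 0 -> (forall a, w.[a] != 0 -> p.[a] = q.[a]) -> p = q.
Proof.
move=> w0 pq; apply/eqP; rewrite -subr_eq0; apply: contraT => pq0.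
have /closed_nonrootP [a] : w * (p - q) != 0 by rewrite mulf_neq0.
by rewrite rootM negb_or /root hornerD hornerN => /andP [/pq -> /eqP[]];
  rewrite subrr.
Qed.

Lemma horner_char_poly (R : comNzRingType) n (A : 'M[R]_n) a :
  (char_poly A).[a] = \det (a%:M - A).
Proof.
rewrite -[LHS]/(horner_eval a _) -det_map_mx; congr (\det _).
by apply/matrixP=> i j; rewrite !mxE /= /horner_eval hornerD hornerN hornerMn
  hornerX hornerC.
Qed.

Section BlockDeterminants.

Variables (R : comPzRingType) (n1 n2 : nat).
Variables (A : 'M[R]_n1) (B : 'M[R]_(n1, n2)) (C : 'M[R]_(n2, n1)) (D : 'M[R]_n2).

(* No block need be invertible: X plays the role of A^-1 B. *)
Lemma det_block_ulmx X :
  A *m X = B -> \det (block_mx A B C D) = \det A * \det (D - C *m X).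
Proof.
move=> AX; rewrite -(det_lblock _ C).
rewrite -[LHS]mulr1 -[in LHS](_ : \det (block_mx 1%:M (- X) 0 1%:M) = 1).
  by rewrite -det_mulmx mulmx_block !mulmx1 !mulmx0 !addr0 !mulmxN AX addNr
    addrC.
by rewrite det_ublock !det1 mulr1.
Qed.

Lemma det_block_drmx X :
  D *m X = C -> \det (block_mx A B C D) = \det D * \det (A - B *m X).
Proof.
move=> DX; rewrite mulrC -(det_ublock _ B).
rewrite -[LHS]mulr1 -[in LHS](_ : \det (block_mx 1%:M 0 (- X) 1%:M) = 1).
  by rewrite -det_mulmx mulmx_block !mulmx1 !mulmx0 !add0r !mulmxN DX addrN.
by rewrite det_lblock !det1 mulr1.
Qed.

End BlockDeterminants.

(** The two numberings differ by a permutation [s], whose matrix conjugates one matrix into the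
    other. This permits numbering the join block by block. *)
Lemma det_reindex (R : comPzRingType) (T : finType) k (g : 'I_k -> T)
    (F : T -> T -> R) : bijective g ->
  \det (\matrix_(i, j) F (g i) (g j)) =
  \det (\matrix_(i < #|T|, j < #|T|) F (enum_val i) (enum_val j)).
Proof.
move=> bij_g; have Ek : k = #|T| by rewrite -(bij_eq_card bij_g) card_ord.
subst k.
have inj_s : injective (enum_rank \o g).
  exact: inj_comp enum_rank_inj (bij_inj bij_g).
pose s := perm inj_s; set N := (X in _ = \det X).
have -> : \matrix_(i, j) F (g i) (g j) = row_perm s (col_perm s N).
  by apply/matrixP=> i j; rewrite !mxE !permE /= !enum_rankK.
rewrite row_permE col_permE !det_mulmx mulrCA -det_mulmx -perm_mxM mulgV.
by rewrite perm_mx1 det1 mulr1.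
Qed.

(** * Laplacian entries and edge counting *)

Definition lap (G : graph) (x y : G) : algC :=
  (degree x)%:R *+ (x == y) - (adj x y)%:R.

Lemma laplacianE (G : graph) i j :
  laplacian G i j = lap (enum_val i) (enum_val j).
Proof. by rewrite !mxE /lap (inj_eq enum_val_inj). Qed.

Lemma degreeE (G : graph) (v : G) : degree v = (\sum_w adj v w)%N.
Proof.
rewrite /degree cardsE -sum1_card big_mkcond.
by apply: eq_bigr => w _; rewrite -topredE /=; case: (adj v w).
Qed.

Lemma sum_enum_val (T : finType) (V : nmodType) (F : T -> V) :
  \sum_(i < #|T|) F (enum_val i) = \sum_v F v.
Proof. by rewrite -big_enum_val. Qed.

(** Each row sum is a degree minus a number of neighbours, hence zero. *)
Lemma laplacian_const (G : graph) n (c : algC) :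
  laplacian G *m const_mx c = 0 :> 'M_(_, n).
Proof.
apply/matrixP=> i j; rewrite !mxE.
under eq_bigr => k _ do rewrite laplacianE mxE.
rewrite (sum_enum_val (fun v => lap (enum_val i) v * c)) -mulr_suml.
rewrite sumrB (bigD1 (enum_val i)) //= eqxx big1 ?addr0; last first.
  by move=> v; rewrite eq_sym => /negPf ->.
by rewrite degreeE natr_sum subrr mul0r.
Qed.

(** The map [u] to [[set v; u]] is a bijection from the neighbours of [v] to the edges at [v]; it is
    injective because a neighbour differs from [v]. *)
Lemma sum_edges_at (G : graph) (v : G) (F : {set G} -> nat) :
  (\sum_(e : edge G | v \in val e) F (val e) =
   \sum_(u | adj v u) F [set v; u])%N.
Proof.
rewrite -(big_sub_cond _ [pred e : {set G} | v \in e]) /=.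
rewrite -(big_imset (h := fun u => [set v; u])) /=; last first.
  move=> u w; rewrite -!topredE /= => vu vw /setP /(_ u).
  rewrite !inE eqxx orbT; case/esym/orP=> /eqP // uv.
  by rewrite uv adj_irr in vu.
apply: eq_bigl => e.
apply/andP/imsetP => [[/imsetP [[x y]]]|[u vu ->]].
  rewrite inE /= => xy -> /=; rewrite !inE => /orP [] /eqP ->.
    by exists y.
  by exists x; rewrite -?topredE /= ?(adj_sym y) // setUC.
split; last by rewrite !inE eqxx.
by apply/imsetP; exists (v, u); rewrite // inE.
Qed.

Lemma card_edge (G : graph) (e : edge G) : #|val e| = 2.
Proof.
case: e => e /= /imsetP [[x y]]; rewrite inE /= => xy ->.
by rewrite cards2; case: eqP xy => // ->; rewrite adj_irr.
Qed.

Lemma handshake (G : graph) : (\sum_(v : G) degree v = #|edge G| * 2)%N.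
Proof.
under eq_bigr => v _.
  rewrite /degree cardsE -sum1_card.
  rewrite -(sum_edges_at v (fun=> 1%N)); over.
(* Exchanging the sums counts each edge once per endpoint. *)
rewrite (exchange_big_dep predT) //= -sum_nat_const.
by apply: eq_bigr => e _; rewrite sum1_card card_edge.
Qed.

(** * The characteristic polynomial of the join *)

Section Svjoin.

Variables G H : graph.
Local Notation m := #|edge G|.

Definition svjoin_index (i : 'I_((#|G| + m) + #|H|)) : svjoin G H :=
  match split i with
  | inl j => match split j with
             | inl v => inl (inl (enum_val v))
             | inr e => inl (inr (enum_val e))
             end
  | inr w => inr (enum_val w)
  end.

Lemma svjoin_index_bij : bijective svjoin_index.
Proof.
apply: inj_card_bij; last by rewrite card_ord !card_sum.
move=> i j; rewrite /svjoin_index.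
case: (split_ordP i) => k ->; case: (split_ordP j) => l ->;
  try case: (split_ordP k) => ? ->; try case: (split_ordP l) => ? -> //;
  case=> // E; rewrite (enum_val_inj E) //.
Qed.

Lemma degree_original (v : G) :
  degree (inl (inl v) : svjoin G H) = (degree v + #|H|)%N.
Proof.
rewrite degreeE big_sumType /= big_sumType /= sum1_card big1 // add0n.
congr addn; rewrite [RHS]/degree cardsE -[RHS]sum1_card.
rewrite -(sum_edges_at v (fun=> 1%N)) [RHS]big_mkcond /=.
by apply: eq_bigr => e _; case: (v \in _).
Qed.

Lemma degree_subdividing (e : edge G) :
  degree (inl (inr e) : svjoin G H) = 2.
Proof.
rewrite degreeE big_sumType /= big_sumType /= -(card_edge e) -sum1_card.
rewrite [X in (_ + X)%N]big1 // addn0 [X in (_ + X)%N]big1 // addn0.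
rewrite [RHS]big_mkcond.
by apply: eq_bigr => v _; case: (v \in _).
Qed.

Lemma degree_joined (w : H) :
  degree (inr w : svjoin G H) = (#|G| + degree w)%N.
Proof.
rewrite degreeE big_sumType /= big_sumType /= sum1_card.
by rewrite [X in (_ + X + _)%N]big1 // addn0 -degreeE.
Qed.

Definition incidence_mx : 'M[algC]_(#|G|, m) :=
  \matrix_(i < #|G|, j < m) ((enum_val i : G) \in val (enum_val j))%:R.

(** The [(i, j)] entry counts the edges containing both vertices: the degree on the diagonal, and
    elsewhere one or zero according to adjacency. *)
Lemma incidence_mulmx_tr :
  incidence_mx *m incidence_mx^T = degree_mx G + adjacency_mx G.
Proof.
apply/matrixP=> i j; rewrite !mxE.
under eq_bigr => k _ do rewrite !mxE -natrM mulnb.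
set v := enum_val i; set w := enum_val j.
transitivity (\sum_(e : edge G) ((v \in val e) && (w \in val e))%:R : algC).
  by rewrite -(sum_enum_val
    (fun e : edge G => ((v \in val e) && (w \in val e))%:R : algC)).
rewrite -natr_sum.
have -> : (\sum_(e : edge G) ((v \in val e) && (w \in val e)) =
   \sum_(e : edge G | v \in val e) (w \in val e))%N.
  by rewrite [RHS]big_mkcond; apply: eq_bigr => e _; case: (v \in _).
rewrite (sum_edges_at v (fun e : {set G} => w \in e : nat)).
have [ij|ij] := eqVneq i j.
  rewrite /w -ij -/v adj_irr addr0 mulr1n /degree cardsE -sum1_card.
  by congr _%:R; apply: eq_bigr => u _; rewrite !inE eqxx.
rewrite mulr0n add0r; congr _%:R.
have wv : w != v by rewrite (inj_eq enum_val_inj) eq_sym.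
(* As [w] differs from [v], the edge [[set v; u]] contains [w] only for [u = w]. *)
rewrite big_mkcond (bigD1 w) //= !inE eqxx orbT big1; first by case: (adj v w).
by move=> u uw; rewrite !inE (negPf wv) eq_sym (negPf uw) if_same.
Qed.

Lemma char_poly_svjoin_block r a : (forall v : G, degree v = r) ->
  (char_poly (laplacian (svjoin G H))).[a] =
  \det (block_mx (block_mx (a - (r + #|H|)%:R)%:M incidence_mx
                           incidence_mx^T (a - 2)%:M)
                 (col_mx (const_mx 1) 0)
                 (row_mx (const_mx 1) 0)
                 ((a - #|G|%:R)%:M - laplacian H)).
Proof.
move=> reg; rewrite horner_char_poly.
pose F (x y : svjoin G H) := a *+ (x == y) - lap x y.
have -> : a%:M - laplacian (svjoin G H) =
    \matrix_(i, j) F (enum_val i) (enum_val j).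
  apply/matrixP=> i j; rewrite [LHS]mxE [X in _ + X]mxE laplacianE !mxE.
  by rewrite /F (inj_eq enum_val_inj).
rewrite -(det_reindex F svjoin_index_bij); congr (\det _).
apply/matrixP=> i j; rewrite [LHS]mxE /svjoin_index /F /lap.
case: (split_ordP i) => k ->; case: (split_ordP j) => l ->;
  try case: (split_ordP k) => ? ->; try case: (split_ordP l) => ? ->;
  rewrite ?block_mxEul ?block_mxEur ?block_mxEdl ?block_mxEdr
    ?block_mxEul ?block_mxEur ?block_mxEdl ?block_mxEdr
    ?col_mxEu ?col_mxEd ?row_mxEl ?row_mxEr.
all: rewrite ?degree_original ?degree_subdividing ?degree_joined ?reg.
all: rewrite /= ?mulr0n ?subr0 ?sub0r ?opprK ?mxE //.
all: rewrite ?sub0r ?opprK //.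
all: try by rewrite eqE /= eqE /= (inj_eq enum_val_inj) -mulrnBl.
by rewrite eqE /= (inj_eq enum_val_inj) natrD !mulrnBl mulrnDl; ring.
Qed.

(** The last determinant stays unevaluated: it sees [H] only through [#|H|], which suffices for
    comparing two joins. *)
Lemma horner_char_poly_svjoin r a (n := #|G|%:R) (t := a - n)
    (p := (a - 2) * (a - (r + #|H|)%:R) - (r * 2)%:R) :
  (forall v : G, degree v = r) -> a - 2 != 0 -> t != 0 -> p != 0 ->
  (char_poly (laplacian (svjoin G H))).[a] =
  (a - 2) ^+ m * ((- (a - 2)^-1) ^+ #|G| * (char_poly (laplacian G)).[- p]) *
  ((char_poly (laplacian H)).[t] *
   \det (1%:M - (n / (p / (a - 2)) / t) *: const_mx 1 : 'M_#|H|)).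
Proof.
move=> reg x0 t0 p0; rewrite (char_poly_svjoin_block _ reg) -/n -/t.
set x := a - 2 in x0 p p0 *; set B := incidence_mx; set s := p / x.
set q := a - _ in p p0 s *; clearbody x q t.
have s0 : s != 0 by rewrite mulf_neq0 ?invr_eq0.
have BB : B *m B^T = (r * 2)%:R%:M - laplacian G.
  rewrite incidence_mulmx_tr; apply/matrixP=> i j.
  by rewrite !mxE reg natrM; case: (i == j); rewrite ?mulr1n ?mulr0n; ring.
have Schur : q%:M - B *m (x^-1 *: B^T) = - x^-1 *: ((- p)%:M - laplacian G).
  rewrite -scalemxAr BB; apply/matrixP=> i j; rewrite !mxE.
  by case: (i == j); rewrite ?mulr1n ?mulr0n /p; field.
clearbody p.
(* The all-ones vector is an eigenvector of the Schur complement, with eigenvalue [s]. *)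
have SJ : (q%:M - B *m (x^-1 *: B^T)) *m (s^-1 *: const_mx 1) =
    const_mx 1 :> 'M_(_, #|H|).
  rewrite Schur -scalemxAl -scalemxAr mulmxBl laplacian_const subr0.
  by apply/matrixP=> i j; rewrite mul_scalar_mx !mxE /s; field; rewrite x0.
pose Y : 'M[algC]_(#|G|, #|H|) := s^-1 *: const_mx 1.
(* The witness solves the block system: the lower row forces its second block, and the upper row
   then reads Schur complement times [Y] equals all ones, which is [SJ]. *)
rewrite (@det_block_ulmx _ _ _ _ _ _ _ (col_mx Y (- (x^-1 *: B^T *m Y)))).
  congr (_ * _).
    rewrite (@det_block_drmx _ _ _ _ _ _ _ (x^-1 *: B^T)).
      by rewrite Schur det_scalar detZ horner_char_poly.
    by rewrite mul_scalar_mx scalerA divff // scale1r.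
  (* The correction is [n / s] times the all-ones matrix J; since [laplacian H] kills J, the matrix
     [t%:M - laplacian H] multiplies J by [t] and factors out on the left. *)
  rewrite horner_char_poly -det_mulmx mul_row_col mul0mx addr0.
  congr (\det _); rewrite mulmxBr mulmx1; congr (_ - _).
  rewrite -[RHS]scalemxAr mulmxBl laplacian_const subr0 mul_scalar_mx.
  apply/matrixP=> i j.
  rewrite !mxE; under eq_bigr do rewrite !mxE.
  rewrite sumr_const card_ord -mulr_natl -/n; field.
  by rewrite s0 t0.
rewrite mul_block_col; congr col_mx.
  by rewrite -SJ mulmxBl mulmxN mulmxA.
by rewrite mul_scalar_mx scalerN -scalemxAl scalerA divff // scale1r addrN.
Qed.

End Svjoin.

(** * Data determined by the Laplacian spectrum, and the comparison of joins *)

Lemma L_cospectralP (G1 G2 : graph) :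
  L_cospectral G1 G2 <-> char_poly (laplacian G1) = char_poly (laplacian G2).
Proof.
split=> [eqs|eqp]; first by rewrite !char_poly_spectrum; apply: perm_big.
apply: prod_XsubC_eq.
by rewrite -!char_poly_spectrum.
Qed.

Lemma L_cospectral_card (G1 G2 : graph) :
  L_cospectral G1 G2 -> #|G1| = #|G2|.
Proof.
move=> /L_cospectralP eqp; apply: succn_inj.
by rewrite -(size_char_poly (laplacian G1)) eqp size_char_poly.
Qed.

Lemma trace_laplacian (G : graph) :
  \tr (laplacian G) = (\sum_(v : G) degree v)%:R.
Proof.
rewrite /mxtrace; under [LHS]eq_bigr => i _ do
  rewrite laplacianE /lap eqxx adj_irr subr0.
by rewrite (sum_enum_val (fun v : G => (degree v)%:R : algC)) natr_sum.
Qed.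

Lemma L_cospectral_sum_degree (G1 G2 : graph) : L_cospectral G1 G2 ->
  (\sum_(v : G1) degree v = \sum_(v : G2) degree v)%N.
Proof.
move=> cosp; apply/eqP; rewrite -(eqr_nat algC) -!trace_laplacian.
(* Minus the trace is the subleading coefficient of the characteristic polynomial. *)
rewrite -eqr_opp -!char_poly_trace ?vertex_gt0 //.
by rewrite (iffLR (L_cospectralP _ _) cosp) (L_cospectral_card cosp).
Qed.

Lemma L_cospectral_svjoin (G1 G2 H1 H2 : graph) :
  regular G1 -> regular G2 -> L_cospectral G1 G2 -> L_cospectral H1 H2 ->
  L_cospectral (svjoin G1 H1) (svjoin G2 H2).
Proof.
move=> [r reg1] [r2 reg2] cospG cospH.
have eqn := L_cospectral_card cospG; have eqh := L_cospectral_card cospH.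
have eqd := L_cospectral_sum_degree cospG.
have eqm : #|edge G1| = #|edge G2|.
  by apply/eqP; rewrite -(eqn_pmul2r (ltn0Sn 1)) -!handshake eqd.
have eqr : r2 = r.
  move: eqd; under eq_bigr do rewrite reg1; under [RHS]eq_bigr do rewrite reg2.
  rewrite !sum_nat_const eqn => /eqP.
  by rewrite eqn_pmul2l ?vertex_gt0 // => /eqP.
rewrite {}eqr in reg2.
apply/L_cospectralP.
pose p := ('X - 2%:P) * ('X - (r + #|H2|)%:R%:P) - (r * 2)%:R%:P : {poly algC}.
(* The excluded values are the zeros of the three denominators in [horner_char_poly_svjoin]; both
   joins share them, since [n], [h] and [r] agree. *)
apply: (@poly_eq_off_roots _ (('X - 2%:P) * ('X - #|G2|%:R%:P) * p)).
  rewrite !mulf_neq0 ?polyXsubC_eq0 // -size_poly_gt0.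
  have size_XX c d : size (('X - c%:P) * ('X - d%:P) : {poly algC}) = 3.
    by rewrite size_mul ?polyXsubC_eq0 // !size_XsubC.
  (* A constant cannot cancel the quadratic leading term of [p]. *)
  by rewrite size_polyDl size_XX // size_polyN size_polyC; case: eqP.
move=> a; rewrite !hornerM !hornerXsubC !mulf_eq0 !negb_or.
case/andP=> /andP [a2 at0]; rewrite hornerD hornerN !hornerM !hornerXsubC hornerC.
move=> ap0; rewrite (@horner_char_poly_svjoin G2 _ r) //.
rewrite (@horner_char_poly_svjoin G1 _ r) //; last by rewrite eqh.
  (* Once the two characteristic polynomials are replaced, [G1] and [H1] survive only through
     cardinalities. *)
  rewrite (iffLR (L_cospectralP _ _) cospG) (iffLR (L_cospectralP _ _) cospH).
  by rewrite eqm eqn eqh.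
by rewrite eqn.
Qed.

Theorem corollary2p11 :
  (forall G1 G2 H : graph,
     regular G1 -> regular G2 -> L_cospectral G1 G2 ->
     L_cospectral (svjoin G1 H) (svjoin G2 H)) /\
  (forall G H1 H2 : graph,
     regular G -> L_cospectral H1 H2 ->
     L_cospectral (svjoin G H1) (svjoin G H2)) /\
  (forall G1 G2 H1 H2 : graph,
     regular G1 -> regular G2 -> L_cospectral G1 G2 -> L_cospectral H1 H2 ->
     L_cospectral (svjoin G1 H1) (svjoin G2 H2)).
Proof.
split=> [G1 G2 H reg1 reg2 cosp|].
  exact/L_cospectral_svjoin/perm_refl.
split=> [G H1 H2 reg cosp|]; last exact: L_cospectral_svjoin.
exact/L_cospectral_svjoin/cosp/perm_refl.
Qed.
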